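(* Let $f=g-h$ with $\inf_{x\in\mathbb{R}^n}f(x)>-\infty$, where $g:\mathbb{R}^n\to\mathbb{R}$ is differentiable with $\nabla g$ being $L$-Lipschitz continuous and $h:\mathbb{R}^n\to\mathbb{R}$ is a finite convex function. Suppose that $f$ has the strong Kurdyka-Łojasiewicz property at any point $x\in\operatorname{dom} f$. Let $\{x^k\}$ be a sequence generated by the generalized proximal point algorithm (GPPA), applied with $g_1=0$ and $g_2=g$ and parameter $t>L$, and let $C^*$ be the set of cluster points of $\{x^k\}$. If $C^*\neq\emptyset$, then $\{x^k\}$ converges to a critical point of $f$.
   Context: GPPA: for a proper function $g_1$ and $t>0$, $\mathbf{prox}_t^{g_1}(x)=\operatorname{argmin}\{g_1(u)+\frac t2\|u-x\|^2: u\in\mathbb{R}^n\}$. A GPPA sequence for $g_1+g_2-h$ with parameter $t>L$ ($L$ the Lipschitz constant of $\nabla g_2$) is any infinite sequence $\{x^k\}_{k\ge0}$ with $x^0\in\operatorname{dom} g_1$ such that, for each $k\ge0$, there is $y^k\in\partial h(x^k)$ (chosen arbitrarily) with $x^{k+1}\in\mathbf{prox}_t^{g_1}\big(x^k-\frac{\nabla g_2(x^k)-y^k}{t}\big)$. Here $g_1=0$ and $g_2=g$, so $x^0\in\mathbb{R}^n$ is arbitrary and $x^{k+1}=x^k-\frac1t(\nabla g(x^k)-y^k)$. Subdifferentials: for convex $h$, $\partial h(\bar x)=\{v:\langle v,x-\bar x\rangle\le h(x)-h(\bar x)\ \forall x\}$. For a lower semicontinuous $\psi$ and $\bar x\in\operatorname{dom}\psi$,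 $\partial^F\psi(\bar x)=\{v:\liminf_{x\to\bar x}\frac{\psi(x)-\psi(\bar x)-\langle v,x-\bar x\rangle}{\|x-\bar x\|}\ge0\}$ and $\partial^L\psi(\bar x)=\{v:\exists\, x^k\to\bar x,\ \psi(x^k)\to\psi(\bar x),\ v^k\in\partial^F\psi(x^k),\ v^k\to v\}$. For $\psi$ locally Lipschitz around $\bar x$, the Clarke subdifferential is $\partial^C\psi(\bar x)=\operatorname{co}\partial^L\psi(\bar x)$ (convex hull). (Here $f$ is locally Lipschitz on $\mathbb{R}^n$ and $\operatorname{dom}f=\mathbb{R}^n$.) Critical point: $\bar x$ is a critical point of $f=g-h$ if $\nabla g(\bar x)\in\partial h(\bar x)$. Strong Kurdyka-Łojasiewicz property of $f$ at $x^*$: there exist $\nu>0$, a neighborhood $\mathcal V$ of $x^*$, and a continuous concave function $\varphi:[0,\nu)\to[0,+\infty)$ such that $\varphi(0)=0$; $\varphi$ is $C^1$ on $(0,\nu)$; $\varphi'>0$ on $(0,\nu)$; and for every $x\in\mathcal V$ with $f(x^* )<f(x)<f(x^* )+\nu$ one has $\varphi'(f(x)-f(x^* ))\,\operatorname{dist}(0,\partial^Cf(x))\ge1$. *)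

(* Defs.v *)
From mathcomp Require Import all_boot all_order all_algebra.
From mathcomp Require Import all_classical all_reals all_analysis.

Set Implicit Arguments.
Unset Strict Implicit.
Unset Printing Implicit Defensive.

Import Order.TTheory GRing.Theory Num.Theory.
Import numFieldNormedType.Exports.

Local Open Scope ring_scope.
Local Open Scope classical_set_scope.

(* The library norm on 'rV[R]_n is the sup norm. All metric quantities below
   use the Euclidean norm [enorm]; limits, neighbourhoods, cluster points and
   differentiability do not depend on the choice of norm and are the
   library's. *)
Definition dotv (R : realType) (n : nat) (u v : 'rV[R]_n) : R :=
  \sum_(i < n) u 0 i * v 0 i.

Definition enorm (R : realType) (n : nat) (u : 'rV[R]_n) : R :=
  Num.sqrt (dotv u u).

(* The value +oo is taken exactly when [A] is empty. *)
Definition edistv (R : realType) (n : nat) (x : 'rV[R]_n) (A : set 'rV[R]_n) :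
  \bar R := ereal_inf [set (enorm (v - x))%:E | v in A].

Definition grad (R : realType) (n : nat) (g : 'rV[R]_n -> R) (x : 'rV[R]_n) :
  'rV[R]_n := \row_(i < n) 'D_(delta_mx 0 i) g x.

Definition convex_hull (R : realType) (n : nat) (A : set 'rV[R]_n) :
  set 'rV[R]_n := smallest (@convex_set R 'rV[R]_n) A.

Definition convex_subdiff (R : realType) (n : nat) (h : 'rV[R]_n -> R)
  (x : 'rV[R]_n) : set 'rV[R]_n :=
  [set v | forall z : 'rV[R]_n, dotv v (z - x) <= h z - h x].

Definition frechet_subdiff (R : realType) (n : nat) (psi : 'rV[R]_n -> R)
  (x : 'rV[R]_n) : set 'rV[R]_n :=
  [set v | (0 <= limf_einf
     (fun z : 'rV[R]_n => ((psi z - psi x - dotv v (z - x)) / enorm (z - x))%:E)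
     (x^'))%E].

Definition limiting_subdiff (R : realType) (n : nat) (psi : 'rV[R]_n -> R)
  (x : 'rV[R]_n) : set 'rV[R]_n :=
  [set v : 'rV[R]_n | exists xs vs : nat -> 'rV[R]_n,
     [/\ xs k @[k --> \oo] --> x,
         psi (xs k) @[k --> \oo] --> psi x,
         forall k, frechet_subdiff psi (xs k) (vs k)
       & vs k @[k --> \oo] --> v]].

(* The Clarke subdifferential, for [psi] locally Lipschitz around [x]. *)
Definition clarke_subdiff (R : realType) (n : nat) (psi : 'rV[R]_n -> R)
  (x : 'rV[R]_n) : set 'rV[R]_n := convex_hull (limiting_subdiff psi x).

(* [phi] is a total function, of which only the restriction to [0, nu)
   matters: all the conditions are conditions on that interval. *)
Definition desingularizing (R : realType) (nu : R) (phi : R -> R) : Prop :=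
  [/\ {within `[0, nu[, continuous phi},
      @convex_function R R^o `[0, nu[ (fun s => - phi s),
      {in `[0, nu[, forall s, 0 <= phi s} /\ phi 0 = 0,
      {in `]0, nu[, forall s, derivable phi s 1} /\
        {in `]0, nu[, continuous phi^`()}
    & {in `]0, nu[, forall s, 0 < phi^`() s}].

Definition strong_KL (R : realType) (n : nat) (f : 'rV[R]_n -> R)
  (xstar : 'rV[R]_n) : Prop :=
  exists (nu : R) (V : set 'rV[R]_n) (phi : R -> R),
    [/\ 0 < nu, nbhs xstar V, desingularizing nu phi
      & forall x, V x -> f xstar < f x < f xstar + nu ->
          (1 <= (phi^`()%classic (f x - f xstar))%:E *
                edistv 0 (clarke_subdiff f x))%E].

Definition prox (R : realType) (n : nat) (g1 : 'rV[R]_n -> \bar R) (t : R)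
  (x : 'rV[R]_n) : set 'rV[R]_n :=
  [set u | forall z, (g1 u + (t / 2 * enorm (u - x) ^+ 2)%:E <=
                      g1 z + (t / 2 * enorm (z - x) ^+ 2)%:E)%E].

Definition gppa_sequence (R : realType) (n : nat) (g1 : 'rV[R]_n -> \bar R)
  (g2 h : 'rV[R]_n -> R) (t : R) (xs : nat -> 'rV[R]_n) : Prop :=
  (g1 (xs 0%N) < +oo)%E /\
  forall k, exists2 y, convex_subdiff h (xs k) y
    & prox g1 t (xs k - t^-1 *: (grad g2 (xs k) - y)) (xs k.+1).

Definition critical_point (R : realType) (n : nat) (g h : 'rV[R]_n -> R)
  (x : 'rV[R]_n) : Prop := convex_subdiff h x (grad g x).

(* Main.v *)
(* With c := t - L > 0, the step identity grad g (x_k) - y_k = t (x_k - x_{k+1})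
   gives the descent f(x_{k+1}) <= f(x_k) - c |x_{k+1} - x_k|^2, where
   f = g - h. The KL inequality can be used along the sequence because
   dist(0, dC f(x)) <= |grad g x - y| for every y in dh(x). Indeed, minimising
   -h + K |. - x0|^2 over small balls yields points z near any prescribed x0
   at which h is bounded above by a quadratic touching it; the slope a of this
   quadratic is a subgradient of h, and grad g z - a is a Frechet subgradient of
   f. Letting z tend to x along a direction p, monotonicity of dh gives a
   limiting subgradient v of f at x with <v, p> <= <grad g x - y, p>.
   As this holds for every p, a Frank-Wolfe iteration in the convex hull bounds
   the distance.
   At a cluster point l, concavity of phi then turns the KL inequality into
   |x_{k+1} - x_k| <= (t / c) (phi(r_k) - phi(r_{k+1})), r_k = f(x_k) - f(l),
   as long as x_k is near l, so that |x_k - l| + (t / c) phi(r_k) decreases and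
   the sequence converges to l. *)
Require Import Defs.
From mathcomp Require Import all_boot all_order all_algebra.
From mathcomp Require Import all_classical all_reals all_analysis.
From mathcomp Require Import ring lra.

Import Order.TTheory GRing.Theory Num.Theory.
Import numFieldNormedType.Exports.

Local Open Scope ring_scope.
Local Open Scope classical_set_scope.

(** * Euclidean norm and inner product, and extraction of subsequences *)

Section euclidean.
Context {R : realType} {n : nat}.
Implicit Types (u v w : 'rV[R]_n) (c : R).

Lemma dotvC u v : dotv u v = dotv v u.
Proof. by apply: eq_bigr => i _; rewrite mulrC. Qed.

Lemma dotvDl u v w : dotv (u + v) w = dotv u w + dotv v w.
Proof. by rewrite -big_split; apply: eq_bigr => i _; rewrite mxE mulrDl. Qed.

Lemma dotvZl c u v : dotv (c *: u) v = c * dotv u v.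
Proof. by rewrite /dotv mulr_sumr; apply: eq_bigr => i _; rewrite mxE mulrA. Qed.

Lemma dotvDr u v w : dotv u (v + w) = dotv u v + dotv u w.
Proof. by rewrite dotvC dotvDl !(dotvC u). Qed.

Lemma dotvZr c u v : dotv u (c *: v) = c * dotv u v.
Proof. by rewrite dotvC dotvZl dotvC. Qed.

Lemma dotvNl u v : dotv (- u) v = - dotv u v.
Proof. by rewrite -scaleN1r dotvZl mulN1r. Qed.

Lemma dotvNr u v : dotv u (- v) = - dotv u v.
Proof. by rewrite dotvC dotvNl dotvC. Qed.

Definition dotvE := (dotvDl, dotvDr, dotvNl, dotvNr, dotvZl, dotvZr).

Lemma dotv0r u : dotv u 0 = 0.
Proof. by rewrite -(scale0r 0) dotvZr mul0r. Qed.

Lemma dotv_ge0 u : 0 <= dotv u u.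
Proof. by apply: sumr_ge0 => i _; rewrite -expr2 sqr_ge0. Qed.

Lemma enorm_ge0 u : 0 <= enorm u.
Proof. exact: sqrtr_ge0. Qed.

Lemma sqr_enorm u : enorm u ^+ 2 = dotv u u.
Proof. by rewrite sqr_sqrtr// dotv_ge0. Qed.

Lemma norm_le_enorm u : `|u| <= enorm u.
Proof.
rewrite [`|u|]mx_normrE; apply/bigmax_leP; split; first exact: enorm_ge0.
move=> [i j] _ /=; rewrite (ord1 i) -sqrtr_sqr ler_wsqrtr//.
rewrite /dotv (bigD1 j)//= expr2 lerDl; apply: sumr_ge0 => k _.
by rewrite -expr2 sqr_ge0.
Qed.

Lemma enorm_le_norm u : enorm u <= n%:R * `|u|.
Proof.
rewrite -[leRHS]ger0_norm ?mulr_ge0// -sqrtr_sqr ler_wsqrtr//.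
have le_coord i : u 0 i * u 0 i <= `|u| ^+ 2.
  rewrite -expr2 -real_normK ?num_real// lerXn2r ?nnegrE//.
  by rewrite [leRHS]mx_normrE; apply/bigmax_geP; right; exists (0, i).
apply: (@le_trans _ _ (\sum_(i < n) `|u| ^+ 2)); first exact: ler_sum.
rewrite sumr_const card_ord exprMn -[leLHS]mulr_natl ler_wpM2r ?sqr_ge0//.
by rewrite -natrX ler_nat; case: (n) => // k; rewrite expnS expn1 leq_pmulr.
Qed.

Lemma enorm_eq0 u : enorm u = 0 -> u = 0.
Proof.
by move=> u0; apply/eqP; rewrite -normr_le0 -u0 norm_le_enorm.
Qed.

(** Cauchy-Schwarz: for [a = enorm u] and [b = enorm v], the squared norm of [b *: u - a *: v] is
    [2 * a * b * (a * b - dotv u v)]. *)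
Lemma dotv_le u v : dotv u v <= enorm u * enorm v.
Proof.
have [/eqP u0|u0] := boolP (enorm u == 0).
  by rewrite u0 (enorm_eq0 _ u0) mul0r dotvC dotv0r.
have [/eqP v0|v0] := boolP (enorm v == 0).
  by rewrite v0 (enorm_eq0 _ v0) mulr0 dotv0r.
have u_gt0 : 0 < enorm u by rewrite lt_def u0 enorm_ge0.
have v_gt0 : 0 < enorm v by rewrite lt_def v0 enorm_ge0.
have := dotv_ge0 (enorm v *: u - enorm u *: v).
rewrite !dotvE -!sqr_enorm (dotvC v u).
set a := enorm u; set b := enorm v; set c := dotv u v => h.
have ab : 0 < a * b by rewrite mulr_gt0.
have : 0 <= 2 * ((a * b) * (a * b - c)) by nra.
by rewrite pmulr_rge0// pmulr_rge0// subr_ge0.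
Qed.

Lemma enormN u : enorm (- u) = enorm u.
Proof. by rewrite /enorm dotvNl dotvNr opprK. Qed.

Lemma enormZ c u : enorm (c *: u) = `|c| * enorm u.
Proof.
by rewrite /enorm dotvZl dotvZr mulrA -expr2 sqrtrM ?sqr_ge0// sqrtr_sqr.
Qed.

Lemma enormD u v : enorm (u + v) <= enorm u + enorm v.
Proof.
rewrite -[leRHS]ger0_norm ?addr_ge0 ?enorm_ge0// -sqrtr_sqr ler_wsqrtr//.
rewrite !dotvE -!sqr_enorm (dotvC v u).
by have := dotv_le u v; nra.
Qed.

Lemma enormB u v : enorm (u - v) = enorm (v - u).
Proof. by rewrite -enormN opprB. Qed.

Lemma dotv_deltar u (i : 'I_n) : dotv u (delta_mx 0 i) = u 0 i.
Proof.
rewrite /dotv (bigD1 i)//= mxE !eqxx mulr1 big1 ?addr0// => j /negPf ji.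
by rewrite mxE ji andbF mulr0.
Qed.

Lemma norm_delta (i : 'I_n) : `|delta_mx 0 i : 'rV[R]_n| <= 1.
Proof.
rewrite [leLHS]mx_normrE; apply/bigmax_leP; split => // -[j k] _ /=.
by rewrite mxE; case: (_ && _); rewrite ?normr1 ?normr0.
Qed.

Lemma norm_leP u c : 0 <= c -> (forall i, `|u 0 i| <= c) -> `|u| <= c.
Proof.
move=> c0 uc; rewrite [leLHS]mx_normrE; apply/bigmax_leP; split => // -[j k] _.
by rewrite (ord1 j).
Qed.

Lemma cvg_dotv {T : Type} {F : set_system T} {FF : Filter F}
    {a b : T -> 'rV[R]_n} {u v} :
  a x @[x --> F] --> u -> b x @[x --> F] --> v ->
  dotv (a x) (b x) @[x --> F] --> dotv u v.
Proof.
move=> au bv; apply: cvg_big => [|i _]; first exact: add_continuous.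
apply: cvgM.
  exact: (cvg_comp _ (fun w : 'rV[R]_n => w 0 i) au
    (@coord_continuous _ _ _ 0 i u)).
exact: (cvg_comp _ (fun w : 'rV[R]_n => w 0 i) bv
  (@coord_continuous _ _ _ 0 i v)).
Qed.

(** The index map is only asked to dominate the identity, not to increase: it then tends to
    infinity, which is all that limits along it use. *)
Lemma cluster_subseq (a : nat -> 'rV[R]_n) l : cluster (a k @[k --> \oo]) l ->
  exists s : nat -> nat, (forall k, (k <= s k)%N) /\ a (s k) @[k --> \oo] --> l.
Proof.
move=> al.
have step k : exists j, (k <= j)%N /\ `|l - a j| < k.+1%:R^-1.
  have [u []] := al [set a j | j in [set j | (k <= j)%N]] (ball l k.+1%:R^-1)
    (filterS (fun j kj => ex_intro2 _ _ j kj erefl) (nbhs_infty_ge k))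
    (nbhsx_ballx l k.+1%:R^-1 ltac:(by [])).
  by move=> [j kj <-]; rewrite -ball_normE => lu; exists j.
have [s sP] := choice step.
exists s; split=> [k|]; first by have [] := sP k.
apply/cvgrPdist_lt => e e0; near=> k.
have [_ /lt_trans] := sP k; apply.
by near: k; exact: near_infty_natSinv_lt (PosNum e0).
Unshelve. all: by end_near. Qed.

Lemma bounded_cvg_subseq (a : nat -> 'rV[R]_n) B : (forall k, `|a k| <= B) ->
  exists (s : nat -> nat) (l : 'rV[R]_n),
    (forall k, (k <= s k)%N) /\ a (s k) @[k --> \oo] --> l.
Proof.
move=> aB.
have cpt : compact [set u : 'rV[R]_n | `|u| <= B].
  apply: bounded_closed_compact.
    exists B; split; first exact: num_real.
    by move=> x Bx u /= uB; rewrite (le_trans uB)// ltW.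
  rewrite (_ : [set _ | _] = closed_ball_ Num.norm 0 B).
    exact: closed_closed_ball_.
  by apply/seteqP; split=> u /=; rewrite /closed_ball_ /= sub0r normrN.
have [|l [_ /cluster_subseq[s sl]]] := cpt (a k @[k --> \oo]) _.
  by exists 0%N => // k _; exact: aB.
by exists s, l.
Qed.

Lemma cvg_subseq (T : topologicalType) (a : nat -> T) (s : nat -> nat) (l : T) :
  (forall k, (k <= s k)%N) -> a k @[k --> \oo] --> l ->
  a (s k) @[k --> \oo] --> l.
Proof.
move=> sk; apply: cvg_comp => A [N _ NA]; exists N => // k /= Nk.
by apply: NA => /=; rewrite (leq_trans Nk).
Qed.

End euclidean.

(** * Local boundedness and continuity of finite convex functions *)

Section convex.
Context {R : realType} {n : nat}.
Implicit Types (u v w x y z d : 'rV[R]_n) (c r s : R).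
Variable h : 'rV[R]_n -> R.
Hypothesis h_convex : @convex_function R 'rV[R]_n [set: 'rV[R]_n] h.

Lemma convexW x y s : 0 <= s <= 1 ->
  h (s *: x + (1 - s) *: y) <= s * h x + (1 - s) * h y.
Proof.
move=> /andP[s0 s1].
exact: (h_convex (Itv01 s0 s1) x y (in_setT _) (in_setT _)).
Qed.

Lemma convex_segment x d s : 0 <= s <= 1 ->
  h (x + s *: d) <= (1 - s) * h x + s * h (x + d).
Proof.
move=> s01; rewrite addrC [leRHS]addrC.
have -> : s *: d + x = s *: (x + d) + (1 - s) *: x.
  by apply/rowP => i; rewrite !mxE; ring.
exact: convexW.
Qed.

Lemma convex_midpoint x d : 2 * h x <= h (x + d) + h (x - d).
Proof.
have := convexW (x + d) (x - d) (2^-1) ltac:(lra).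
have -> : 2^-1 *: (x + d) + (1 - 2^-1) *: (x - d) = x.
  by apply/rowP => i; rewrite !mxE; field.
by lra.
Qed.

Lemma convex_bounded_above x r :
  exists M, forall d, `|d| <= r -> h (x + d) <= M.
Proof.
(* Induction on the number [m] of leading coordinates in which [d] may be nonzero. *)
suff bnd m : exists M, forall d, `|d| <= r ->
    (forall i : 'I_n, (m <= i)%N -> d 0 i = 0) -> h (x + d) <= M.
  have [M hM] := bnd n; exists M => d dr; apply: hM => // i.
  by rewrite leqNgt ltn_ord.
elim: m r => [|m IH] r.
  exists (h x) => d _ d0; rewrite (_ : d = 0) ?addr0//.
  by apply/rowP => i; rewrite d0// mxE.
have [mn|nm] := ltnP m n; last first.
  have [M hM] := IH r; exists M => d dr _; apply: hM => // i mi.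
  by have := ltn_ord i; rewrite ltnNge (leq_trans nm).
(* The radius doubles because [x + d] is the midpoint of [x + 2 *: d'], where [d'] has its last free
   coordinate erased, and [x + (2 * c) *: e]. The latter lies on a segment of the axis [e], where
   [h] is at most the larger of its two end values. *)
have [M hM] := IH (2 * r).
pose e : 'rV[R]_n := delta_mx 0 (Ordinal mn).
pose N := Num.max (h (x + (2 * r) *: e)) (h (x + (- (2 * r)) *: e)).
exists (2^-1 * M + 2^-1 * N) => d dr d0.
pose c := d 0 (Ordinal mn).
have cr : `|c| <= r.
  by rewrite (le_trans _ dr)// [leRHS]mx_normrE; apply/bigmax_geP; right;
    exists (0, Ordinal mn).
pose d' := d - c *: e.
have d'E i : d' 0 i = if i == Ordinal mn then 0 else d 0 i.
  by rewrite !mxE eqxx /=; case: eqP => [->|_]; rewrite ?mulr1 ?subrr ?mulr0 ?subr0.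
have r0 : 0 <= r by rewrite (le_trans _ dr).
have h1 : h (x + 2 *: d') <= M.
  apply: hM => [|i mi].
    rewrite normrZ ger0_norm// ler_wpM2l//; apply: norm_leP => // i.
    rewrite d'E; case: ifP => _; rewrite ?normr0//.
    by rewrite (le_trans _ dr)// [leRHS]mx_normrE; apply/bigmax_geP; right;
      exists (0, i).
  rewrite mxE d'E; case: eqP => [_|/eqP im]; first by rewrite mulr0.
  rewrite d0 ?mulr0// ltn_neqAle mi andbT; apply: contra im => /eqP mi'.
  by apply/eqP/val_inj.
have h2 : h (x + (2 * c) *: e) <= N.
  have [r00|r00] := eqVneq r 0.
    have c0 : c = 0 by apply/eqP; rewrite -normr_le0 -r00.
    by rewrite c0 /N r00 !mulr0 oppr0 maxxx.
  have rp : 0 < r by rewrite lt_def r00.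
  pose s := (c + r) / (2 * r).
  have s01 : 0 <= s <= 1.
    move: cr; rewrite ler_norml => /andP[? ?].
    by rewrite /s divr_ge0 ?ler_pdivrMr /=; lra.
  have -> : x + (2 * c) *: e =
      s *: (x + (2 * r) *: e) + (1 - s) *: (x + (- (2 * r)) *: e).
    apply/rowP => i; rewrite !mxE; set ei := (_%:R : R); rewrite /s; field.
    exact: r00.
  apply: (le_trans (convexW _ _ _ s01)).
  have : h (x + (2 * r) *: e) <= N by rewrite le_max lexx.
  have : h (x + (- (2 * r)) *: e) <= N by rewrite le_max lexx orbT.
  by case/andP: s01; nra.
have -> : x + d = 2^-1 *: (x + 2 *: d') + (1 - 2^-1) *: (x + (2 * c) *: e).
  by apply/rowP => i; rewrite !mxE; set ei := (_%:R : R); field.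
apply: (le_trans (convexW _ _ _ _)); first by lra.
by lra.
Qed.

(** Convexity turns an upper bound into a lower one, through [h (x + d) >= 2 * h x - h (x - d)]. *)
Lemma convex_bounded x r :
  exists M, 0 <= M /\ forall d, `|d| <= r -> `|h (x + d)| <= M.
Proof.
have [M hM] := convex_bounded_above x r.
exists (`|M| + `|2 * h x|); split=> [|d dr]; first exact: addr_ge0.
have := convex_midpoint x d; have := hM _ dr; have := hM (- d).
rewrite normrN => /(_ dr) h1 h2 h3.
rewrite ler_norml; have := ler_norm M; have := ler_norm (- (2 * h x)).
have := ler_norm (2 * h x); have := normr_ge0 M.
by rewrite normrN; lra.
Qed.

(** For [d] of norm at most 1, the chord from [x] to the point at distance 1 in the direction of [d]
    gives [h (x + d) - h x <= 2 * M * |d|]. The same bound for [- d] and midpoint convexity give the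
    lower estimate. *)
Lemma convex_continuous : continuous h.
Proof.
move=> x; apply/(@cvgrPdist_lt _ _ _ (nbhs x) (nbhs_filter x)) => e e0.
have [M [M0 hM]] := convex_bounded x 1.
have hx : `|h x| <= M by have := hM 0; rewrite normr0 addr0; apply.
near=> y; pose d := y - x.
have dx : y = x + d by rewrite addrC subrK.
have [d00|d0] := eqVneq d 0; first by rewrite dx d00 addr0 subrr normr0.
have dp : 0 < `|d| by rewrite normr_gt0.
have : `|d| < Num.min 1 (e / (2 * M + 1)).
  rewrite distrC; near: y; apply/nbhs_ballP.
  exists (Num.min 1 (e / (2 * M + 1))) => [|z]; last by rewrite -ball_normE.
  by rewrite /= lt_min ltr01 divr_gt0//; lra.
rewrite lt_min ltr_pdivlMr; last by lra.
move=> /andP[/ltW d1 dM].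
have seg v : `|v| = 1 -> h (x + `|d| *: v) - h x <= `|d| * (2 * M).
  move=> v1; have := convex_segment x v `|d| ltac:(by rewrite normr_ge0 d1).
  have := hM v ltac:(by rewrite v1); have := hx; rewrite !ler_norml.
  move=> /andP[? ?] /andP[? ?]; nra.
have v1 : `| `|d|^-1 *: d | = 1.
  by rewrite normrZ normfV normr_id mulVf// gt_eqF.
have := seg _ v1; have := seg (- (`|d|^-1 *: d)); rewrite normrN => /(_ v1).
rewrite scalerN scalerA mulfV ?gt_eqF// scale1r => h1 h2.
have := convex_midpoint x d.
by rewrite dx distrC ltr_norml; lra.
Unshelve. all: by end_near. Qed.

End convex.

(** * Subgradients of a finite convex function *)

Section subgradients.
Context {R : realType} {n : nat}.
Implicit Types (u v w x y z d a : 'rV[R]_n) (c r s : R).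
Variable h : 'rV[R]_n -> R.
Hypothesis h_convex : @convex_function R 'rV[R]_n [set: 'rV[R]_n] h.

(** The quadratic bound at [- s d], reflected by midpoint convexity, yields [h (z + s d) >= h z + s
    <a, d> - K s^2 |d|^2]. The chord inequality bounds the left side by [(1 - s) h z + s h (z + d)];
    after division by [s] the error is of order [s]. *)
Lemma quad_above_subgradient z a K r : 0 < r ->
  (forall d, `|d| <= r -> h (z + d) <= h z + dotv a d + K * dotv d d) ->
  convex_subdiff h z a.
Proof.
move=> r0 hK y; have [d ->] : exists d, y = z + d.
  by exists (y - z); rewrite addrC subrK.
rewrite [z + d - z]addrAC subrr add0r.
rewrite lerBrDr; apply/ler_addgt0Pr => e e0.
pose q := `|d| + 1.
have q0 : 0 < q by rewrite /q ltr_wpDl.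
(* The three bounds serve the chord inequality, the range of the quadratic bound, and an error of at
   most [e]. *)
pose s := Num.min 1 (Num.min (r / q) (e / (`|K| * dotv d d + 1))).
have Kd : 0 <= `|K| * dotv d d by rewrite mulr_ge0// dotv_ge0.
have s0 : 0 < s by rewrite !lt_min ltr01 !divr_gt0//; lra.
have s1 : s <= 1 by rewrite /s !ge_min lexx.
have sr : s * `|d| <= r.
  have : s <= r / q by rewrite /s !ge_min lexx orbT.
  by rewrite ler_pdivlMr// /q; nra.
have se : s * (`|K| * dotv d d) <= e.
  have : s <= e / (`|K| * dotv d d + 1) by rewrite /s !ge_min lexx !orbT.
  by rewrite ler_pdivlMr; nra.
have := hK (- (s *: d)); rewrite normrN normrZ gtr0_norm// => /(_ sr).
rewrite !dotvE => h1.
have h2 := convex_midpoint _ h_convex z (s *: d).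
have h3 := convex_segment _ h_convex z d s ltac:(by rewrite ltW).
have KK : K * dotv d d <= `|K| * dotv d d.
  by rewrite ler_wpM2r ?dotv_ge0 ?ler_norm.
suff : 0 <= s * (h (z + d) + e - (dotv a d + h z)).
  by rewrite pmulr_rge0// subr_ge0.
by nra.
Qed.

Lemma exists_quad_above x r : 0 < r ->
  exists z a, `|z - x| < r /\ exists K r', 0 < r' /\
    forall d, `|d| <= r' -> h (z + d) <= h z + dotv a d + K * dotv d d.
Proof.
move=> r0; have [M [M0 hM]] := convex_bounded _ h_convex x r.
(* On the boundary of the ball [psi] is then at least [K * r ^+ 2 - M = M + 1], while [psi x <= M],
   so the minimiser is interior. *)
pose K := (2 * M + 1) / r ^+ 2.
have K0 : 0 < K by rewrite divr_gt0 ?exprn_gt0//; lra.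
have Kr : K * r ^+ 2 = 2 * M + 1 by rewrite /K divfK// gt_eqF ?exprn_gt0.
pose A := closed_ball_ Num.norm x r.
pose psi z := K * dotv (z - x) (z - x) - h z.
have xA : A x by rewrite /A /closed_ball_ /= subrr normr0 ltW.
have cpt : compact A.
  apply: bounded_closed_compact; last exact: closed_closed_ball_.
  exists (`|x| + r); split; first exact: num_real.
  move=> c xc u; rewrite /A /closed_ball_ /= => xu; rewrite (le_trans _ (ltW xc))//.
  by rewrite -[u](subKr x) (le_trans (ler_normB _ _))// lerD2l.
have cont : continuous psi.
  move=> z; have FF := nbhs_filter z.
  have cvg_sub : (w - x) @[w --> z] --> z - x.
    by apply: (cvgB (F := nbhs z)); [exact: cvg_id | exact: cvg_cst].
  have cvg_dot := @cvg_dotv _ _ _ (nbhs z) FF _ _ _ _ cvg_sub cvg_sub.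
  have cvg_quad : K * dotv (w - x) (w - x) @[w --> z] --> K * dotv (z - x) (z - x).
    exact: (cvgM (F := nbhs z) (cvg_cst K) cvg_dot).
  exact: (cvgB (F := nbhs z) cvg_quad (convex_continuous _ h_convex z)).
have [z] := EVT_min_rV (ex_intro _ x xA) cpt
  (continuous_subspaceT cont).
rewrite inE /A /closed_ball_ /= => xz zmin.
have zA : `|z - x| <= r by rewrite distrC.
have zr : `|z - x| < r.
  have := zmin x (mem_set xA); rewrite /psi subrr dotv0r mulr0.
  have := hM 0; rewrite normr0 addr0 => /(_ (ltW r0)); rewrite ler_norml => /andP[? ?].
  have := hM (z - x) zA; rewrite addrC subrK ler_norml.
  move=> /andP[? ?] ?; rewrite ltNge; apply/negP => rz.
  have : r ^+ 2 <= dotv (z - x) (z - x).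
    rewrite -sqr_enorm ler_pXn2r ?nnegrE ?enorm_ge0 ?(ltW r0)//.
    exact: le_trans rz (norm_le_enorm _).
  rewrite -(ler_pM2l K0) Kr.
  by lra.
(* Expanding the square in [psi z <= psi (z + d)] produces this slope, with curvature [K]. *)
exists z, ((2 * K) *: (z - x)); split => //.
exists K, (r - `|z - x|); split=> [|d dr]; first by rewrite subr_gt0.
have : A (z + d).
  rewrite /A /closed_ball_ /= distrC addrAC (le_trans (ler_normD _ _))//; lra.
move=> /mem_set /zmin; rewrite /psi addrAC !dotvE (dotvC x z) (dotvC d z) (dotvC d x).
by nra.
Qed.

Lemma subgradient_bounded x r :
  exists B, forall z a, `|z - x| <= r -> convex_subdiff h z a -> enorm a <= B.
Proof.
(* Radius [r + 1] leaves room for unit displacements [d] from [z], at which the subgradient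
   inequality gives [dotv a d <= 2 * M]; the vectors [delta_mx] and their opposites then bound every
   coordinate of [a]. *)
have [M [M0 hM]] := convex_bounded _ h_convex x (r + 1).
exists (n%:R * (2 * M)) => z a zr az.
rewrite (le_trans (enorm_le_norm a))// ler_wpM2l//.
have hz d : `|d| <= 1 -> dotv a d <= 2 * M.
  move=> d1; have := az (z + d); rewrite addrAC subrr add0r.
  have := hM (z - x + d); have := hM (z - x).
  rewrite !addrA ![x + z]addrC !addrK => /(_ ltac:(lra)) h1.
  move=> /(_ ltac:(by rewrite (le_trans (ler_normD _ _))// lerD)) h2.
  by move: h1 h2; rewrite !ler_norml => /andP[? ?] /andP[? ?]; lra.
apply: norm_leP => [|i]; first lra.
rewrite ler_norml -dotv_deltar lerNl -dotvNr !hz// ?normrN norm_delta//.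
Qed.

Lemma subgradient_closed (xs vs : nat -> 'rV[R]_n) x a :
  xs k @[k --> \oo] --> x -> vs k @[k --> \oo] --> a ->
  (forall k, convex_subdiff h (xs k) (vs k)) -> convex_subdiff h x a.
Proof.
move=> xx va sub y.
have c1 : dotv (vs k) (y - xs k) @[k --> \oo] --> dotv a (y - x).
  by apply: cvg_dotv => //; apply: cvgB => //; exact: cvg_cst.
have c2 : h y - h (xs k) @[k --> \oo] --> h y - h x.
  apply: cvgB; first exact: cvg_cst.
  exact: (continuous_cvg _ (convex_continuous _ h_convex x) xx).
by apply: (ler_cvg_to c1 c2); apply: nearW => k; exact: sub.
Qed.

Lemma subgradient_monotone x y a b :
  convex_subdiff h x a -> convex_subdiff h y b -> 0 <= dotv (a - b) (x - y).
Proof.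
move=> /(_ y) + /(_ x).
by rewrite !dotvE; lra.
Qed.

End subgradients.

(** * Fréchet subgradients, and the distance from 0 to a convex set *)

Section clarke.
Context {R : realType} {n : nat}.
Implicit Types (u v w x y z d a p : 'rV[R]_n) (c r s : R).

Lemma diff_grad (g : 'rV[R]_n -> R) x d :
  differentiable g x -> 'd g x d = dotv (grad g x) d.
Proof.
move=> dg; rewrite [in LHS](row_sum_delta d) linear_sum.
by apply: eq_bigr => i _; rewrite linearZ /= mxE deriveE// mulrC.
Qed.

Lemma diff_near (g : 'rV[R]_n -> R) x e : differentiable g x -> 0 < e ->
  \forall d \near (0 : 'rV[R]_n),
    `|g (x + d) - g x - dotv (grad g x) d| <= e * `|d|.
Proof.
move=> dg e0; have /eqaddoP/(_ _ e0) := diff_locally dg.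
apply: filterS => d /=.
by rewrite -diff_grad//= !fctE /= opprD addrA [d + x]addrC.
Qed.

Lemma frechet_subdiffI (f : 'rV[R]_n -> R) x v :
  (forall e, 0 < e -> \forall d \near (0 : 'rV[R]_n),
    - (e * enorm d) <= f (x + d) - f x - dotv v d) ->
  frechet_subdiff f x v.
Proof.
move=> fv; rewrite /frechet_subdiff /= limf_einfE.
apply/lee_addgt0Pr => e e0.
rewrite -leeBlDr// sub0e.
have [r /= r0 rP] := (nbhs_ballP _ _).1 (fv e e0).
pose V := [set z | z != x /\ `|x - z| < r].
apply: (@le_trans _ _ (ereal_inf [set ((f z - f x - dotv v (z - x)) / enorm (z - x))%:E
  | z in V])).
  apply: le_ereal_inf_tmp => _ [z [zx zr] <-].
  have d0 : 0 < enorm (z - x).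
    rewrite (lt_le_trans _ (norm_le_enorm _))// normr_gt0 subr_eq0//.
  rewrite lee_fin ler_pdivlMr// mulNr.
  have := rP (z - x); rewrite /= -ball_normE /= sub0r normrN distrC => /(_ zr).
  by rewrite [x + _]addrC subrK.
apply: ereal_sup_ubound; exists V => //.
apply/nbhs_ballP; exists r => // z; rewrite -ball_normE /= => zr zx.
by split.
Qed.

(** The remainder of [g] at first order is o(|d|), and the excess of [h] over its linear part is at
    most quadratic, hence bounded above by o(|d|) as well. *)
Lemma frechet_subdiff_quad (g h : 'rV[R]_n -> R) x a K r :
  differentiable g x -> 0 < r ->
  (forall d, `|d| <= r -> h (x + d) <= h x + dotv a d + K * dotv d d) ->
  frechet_subdiff (fun z => g z - h z) x (grad g x - a).
Proof.
move=> dg r0 hK; apply: frechet_subdiffI => e e0.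
have e2 : 0 < e / 2 by lra.
have := diff_near _ _ _ dg e2; apply: filter_app.
(* The factor [n%:R + 1] passes from the sup norm to the Euclidean one, so that
   [|K| * enorm d <= e / 2]. *)
pose q := Num.min r (e / 2 / ((n%:R + 1) * (`|K| + 1))).
have q0 : 0 < q.
  by rewrite lt_min r0 divr_gt0// mulr_gt0// ltr_wpDl.
near=> d.
have dq : `|d| <= q.
  rewrite -normrN -sub0r; near: d; apply/nbhs_ballP; exists q => //= d.
  by rewrite -ball_normE /= => /ltW.
move: dq; rewrite le_min => /andP[/hK hd].
rewrite ler_pdivlMr ?mulr_gt0 ?ltr_wpDl// => dK.
rewrite ler_norml => /andP[gd _].
have eK : `|K| * enorm d <= e / 2.
  apply: le_trans dK; rewrite mulrC mulrA ler_pM ?enorm_ge0//; last by rewrite lerDl.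
  by rewrite mulrDr mulr1 mulrC (le_trans (enorm_le_norm d))// lerDl.
have eKK : K * dotv d d <= e / 2 * enorm d.
  rewrite -sqr_enorm expr2 mulrA ler_wpM2r ?enorm_ge0// (le_trans _ eK)//.
  by rewrite ler_wpM2r ?enorm_ge0// ler_norm.
have : e / 2 * `|d| <= e / 2 * enorm d by rewrite ler_pM2l// norm_le_enorm.
by rewrite !dotvE; lra.
Unshelve. all: by end_near. Qed.

(** If all of [A] stayed farther than [enorm w + e] from 0, moving from [v] a fraction [l] towards
    the point supplied for the direction [p = v] would lower the squared norm by at least
    [l * e ^+ 2]. Iterating from a point of norm at most [B] would make it negative. *)
Lemma edistv_convex (A : set 'rV[R]_n) w B :
  @convex_set R 'rV[R]_n A ->
  (forall p, exists v, [/\ A v, enorm v <= B & dotv v p <= dotv w p]) ->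
  (edistv 0 A <= (enorm w)%:E)%E.
Proof.
move=> cA hA; apply/lee_addgt0Pr => e e0.
suff [v Av vw] : exists2 v, A v & enorm v <= enorm w + e.
  apply: (@le_trans _ _ (enorm v)%:E); last by rewrite -EFinD lee_fin.
  by apply: ereal_inf_lbound; exists v; rewrite ?subr0.
apply: contrapT => noA.
have far v : A v -> enorm w + e < enorm v.
  by move=> Av; rewrite ltNge; apply/negP => vw; apply: noA; exists v.
have [v0 [Av0 v0B _]] := hA 0.
have w0 := enorm_ge0 w.
have B0 : 0 <= B := le_trans (enorm_ge0 _) v0B.
(* Small enough that the second-order term, at most [l ^+ 2 * (2 * B ^+ 2)], costs no more than half
   of the first-order gain [2 * l * e ^+ 2]. The added [e ^+ 2] keeps the denominator positive. *)
pose l := e ^+ 2 / (2 * B ^+ 2 + e ^+ 2).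
have e20 : 0 < e ^+ 2 by rewrite exprn_gt0.
have B2 : 0 <= B ^+ 2 by rewrite sqr_ge0.
have D0 : 0 < 2 * B ^+ 2 + e ^+ 2 by lra.
have lE : l * (2 * B ^+ 2 + e ^+ 2) = e ^+ 2 by rewrite divfK// gt_eqF.
have l0 : 0 < l by rewrite divr_gt0.
have l1 : l <= 1 by rewrite ler_pdivrMr//; lra.
have descent k : exists2 v, A v & dotv v v <= B ^+ 2 - k%:R * (l * e ^+ 2).
  elim: k => [|k [v Av vk]].
    exists v0 => //; rewrite mul0r subr0 -sqr_enorm.
    by rewrite ler_pXn2r// nnegrE// enorm_ge0.
  have [u [Au uB uv]] := hA v.
  exists (l *: u + (1 - l) *: v).
    have l01 : 0 <= l <= 1 by rewrite ltW.
    case/andP: l01 => l0' l1'.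
    have := cA u v (Itv01 l0' l1') (mem_set Au) (mem_set Av).
    by move=> /set_mem.
  have vf := far _ Av.
  have wv := dotv_le w v.
  have vB : enorm v <= B.
    rewrite -(@ler_pXn2r _ 2)// ?nnegrE ?enorm_ge0// sqr_enorm (le_trans vk)//.
    by rewrite gerBl mulr_ge0// mulr_ge0// ltW.
  rewrite !dotvE (dotvC v u) -natr1 -!sqr_enorm.
  move: vk; rewrite -sqr_enorm => vk; have u0 := enorm_ge0 u.
  have uv' : dotv u v <= enorm w * enorm v by lra.
  have a1 : enorm u ^+ 2 <= B ^+ 2 by nra.
  have a2 : enorm v ^+ 2 <= B ^+ 2 by nra.
  have a3 : e ^+ 2 <= enorm v * (enorm v - enorm w) by nra.
  have a4 : l * (1 - l) * dotv u v <= l * (1 - l) * (enorm w * enorm v).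
    by rewrite ler_wpM2l// mulr_ge0//; lra.
  have a5 : l * e ^+ 2 <= l * (enorm v * (enorm v - enorm w)) by rewrite ler_wpM2l// ltW.
  have a6 : 0 <= l ^+ 2 * (2 * (enorm w * enorm v)).
    by rewrite mulr_ge0 ?sqr_ge0// mulr_ge0// mulr_ge0// enorm_ge0.
  have a7 : l ^+ 2 * (enorm v ^+ 2 + enorm u ^+ 2) <= l * e ^+ 2.
    rewrite expr2 -mulrA ler_pM2l// -lE ler_wpM2l ?ltW//; lra.
  nra.
have le20 : 0 < l * e ^+ 2 by rewrite mulr_gt0.
have [v Av] := descent (Num.bound (B ^+ 2 / (l * e ^+ 2))).
have := archi_boundP (divr_ge0 B2 (ltW le20)).
rewrite ltr_pdivrMr// => h1 h2.
have := dotv_ge0 v; lra.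
Qed.

Lemma convex_hull_convex (A : set 'rV[R]_n) :
  @convex_set R 'rV[R]_n (convex_hull A).
Proof.
move=> x y l /set_mem xA /set_mem yA; apply/mem_set => M [cM AM].
by apply/set_mem/cM; apply/mem_set; [exact: xA | exact: yA].
Qed.

End clarke.

(** * Clarke subgradients of a difference [g - h] *)

Section dc.
Context {R : realType} {n : nat}.
Implicit Types (u v w x y z d a p : 'rV[R]_n) (c r s : R).
Variables g h : 'rV[R]_n -> R.
Hypothesis g_diff : forall x, differentiable g x.
Hypothesis grad_cont : continuous (grad g).
Hypothesis h_convex : @convex_function R 'rV[R]_n [set: 'rV[R]_n] h.

Lemma limiting_subdiff_below x y p : convex_subdiff h x y ->
  exists2 a, convex_subdiff h x a & dotv y p <= dotv a p /\
    limiting_subdiff (fun z => g z - h z) x (grad g x - a).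
Proof.
move=> yx; pose s k : R := k.+1%:R^-1.
have s0 k : 0 < s k by rewrite invr_gt0.
have s1 k : s k <= 1 by rewrite invf_le1// ler1n.
(* The radius [s k ^+ 2] is of smaller order than the displacement [s k *: p], so the rescaled
   displacements [ws k] still tend to [p]. *)
have step k : exists za : 'rV[R]_n * 'rV[R]_n,
    [/\ `|za.1 - (x + s k *: p)| < s k ^+ 2, convex_subdiff h za.1 za.2
      & frechet_subdiff (fun z => g z - h z) za.1 (grad g za.1 - za.2)].
  have [|z [a [zr [K [r [r0 hK]]]]]] :=
    exists_quad_above _ h_convex (x + s k *: p) (s k ^+ 2).
    by rewrite exprn_gt0.
  exists (z, a); split => //=; first exact: quad_above_subgradient hK.
  exact: frechet_subdiff_quad hK.
have [za zaP] := choice step.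
pose zs k := (za k).1; pose as_ k := (za k).2.
have zas k : convex_subdiff h (zs k) (as_ k) by have [] := zaP k.
pose ws k := (s k)^-1 *: (zs k - x).
have ws_p k : `|p - ws k| < s k.
  have -> : p - ws k = - ((s k)^-1 *: (zs k - (x + s k *: p))).
    by rewrite /ws; apply/rowP => i; rewrite !mxE; field; rewrite gt_eqF.
  rewrite normrN normrZ gtr0_norm ?invr_gt0// mulrC ltr_pdivrMr//.
  by have [] := zaP k; rewrite expr2.
have zsE k : zs k = x + s k *: ws k.
  by rewrite /ws scalerA mulfV ?gt_eqF// scale1r addrC subrK.
have s_cvg : s k @[k --> \oo] --> 0 by exact: cvg_harmonic.
have ws_cvg : ws k @[k --> \oo] --> p.
  apply/cvgrPdist_lt => e e0; near=> k; rewrite (lt_trans (ws_p k))//.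
  by near: k; exact: near_infty_natSinv_lt (PosNum e0).
have zs_cvg : zs k @[k --> \oo] --> x.
  rewrite (_ : zs = fun k => x + s k *: ws k); last by apply/funext.
  rewrite -[X in _ --> X]addr0 -(scale0r p).
  by apply: cvgD; [exact: cvg_cst | exact: cvgZ].
have [B aB] := subgradient_bounded _ h_convex x (`|p| + 1).
have as_bnd k : `|as_ k| <= B.
  rewrite (le_trans (norm_le_enorm _))// (aB (zs k))//.
  rewrite zsE addrAC subrr add0r normrZ gtr0_norm//.
  have : `|ws k| <= `|p| + 1.
    rewrite -[ws k](subKr p) (le_trans (ler_normB _ _))// lerD2l.
    by rewrite (le_trans (ltW (ws_p k))).
  by apply: le_trans; rewrite ler_piMl.
have [q [a [qk qa]]] := bounded_cvg_subseq _ _ as_bnd.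
have zq_cvg := cvg_subseq _ _ _ _ qk zs_cvg.
have wq_cvg := cvg_subseq _ _ _ _ qk ws_cvg.
exists a; first exact: (subgradient_closed _ h_convex _ _ _ _ zq_cvg qa).
split.
  (* Monotonicity gives [dotv (as_ k - y) (zs k - x) >= 0]; dividing by [s k] and passing to the
     limit gives the inequality in the direction [p]. *)
  rewrite -subr_ge0 -dotvNl -dotvDl.
  have c : dotv (as_ (q k) - y) (ws (q k)) @[k --> \oo] --> dotv (a - y) p.
    by apply: cvg_dotv => //; apply: cvgB => //; exact: cvg_cst.
  apply: (cvgr_to_ge c); apply: nearW => k.
  rewrite dotvZr mulr_ge0 ?invr_ge0 ?(ltW (s0 _))//.
  exact: (subgradient_monotone h).
exists (zs \o q), (fun k => grad g (zs (q k)) - as_ (q k)); split => //=.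
- apply: cvgB.
    exact: (continuous_cvg _ (differentiable_continuous (g_diff x)) zq_cvg).
  exact: (continuous_cvg _ (convex_continuous _ h_convex x) zq_cvg).
- by move=> k; have [] := zaP (q k).
- by apply: cvgB => //; exact: (continuous_cvg _ (grad_cont x) zq_cvg).
Unshelve. all: by end_near. Qed.

(* Only the inclusion of [grad g x - y] in the closure of the Clarke
   subdifferential is used, which avoids compactness of convex hulls. *)
Lemma clarke_dist x y : convex_subdiff h x y ->
  (edistv 0 (clarke_subdiff (fun z => (g z - h z)%R) x) <=
   (enorm (grad g x - y))%:E)%E.
Proof.
move=> yx; have [B aB] := subgradient_bounded _ h_convex x 0.
apply: (@edistv_convex _ _ _ _ (enorm (grad g x) + B)).
  exact: convex_hull_convex.
move=> p; have [a ax [ya lim]] := limiting_subdiff_below x y p yx.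
exists (grad g x - a); split.
- exact: sub_gen_smallest.
- rewrite (le_trans (enormD _ _))// enormN lerD2l (aB x)//.
  by rewrite subrr normr0.
- by rewrite !dotvE lerD2l lerN2.
Qed.

End dc.

(** * Functions with Lipschitz gradient *)

Section lipschitz_gradient.
Context {R : realType} {n : nat}.
Implicit Types (x y d : 'rV[R]_n).
Variables (g : 'rV[R]_n -> R) (L : R).
Hypothesis g_diff : forall x, differentiable g x.
Hypothesis grad_lip : forall x y,
  enorm (grad g x - grad g y) <= L * enorm (x - y).

Lemma grad_continuous : continuous (grad g).
Proof.
move=> x; apply/(@cvgrPdist_lt _ _ _ (nbhs x) (nbhs_filter x)) => e e0.
pose q := e / ((`|L| + 1) * (n%:R + 1)).
have q0 : 0 < q by rewrite divr_gt0// mulr_gt0// ltr_wpDl.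
apply/nbhs_ballP; exists q => // y; rewrite -ball_normE /= => xy.
rewrite (le_lt_trans (norm_le_enorm _))// (le_lt_trans (grad_lip _ _))//.
move: xy; rewrite ltr_pdivlMr ?mulr_gt0 ?ltr_wpDl//; apply: le_lt_trans.
rewrite (le_trans (ler_wpM2r (enorm_ge0 _) (ler_norm L)))//.
rewrite (le_trans (ler_wpM2l (normr_ge0 L) (enorm_le_norm _)))//.
rewrite -subr_ge0 (_ : _ - _ = `|x - y| * (`|L| + n%:R + 1)); last by ring.
by rewrite mulr_ge0// !addr_ge0.
Qed.

Lemma is_derive_line x d (s : R) :
  is_derive s 1 (fun r : R => g (x + r *: d)) (dotv (grad g (x + s *: d)) d).
Proof.
set F := fun r : R => g (x + r *: d).
have E : (fun r : R => r^-1 *: ((F \o shift s) (r *: 1) - F s)) =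
    (fun r : R => r^-1 *: ((g \o shift (x + s *: d)) (r *: d) - g (x + s *: d))).
  apply/funext => r; congr (_ *: (_ - _)); congr g.
  by rewrite /= [r *: 1]mulr1 scalerDl addrCA.
constructor; first by rewrite /derivable E; exact: diff_derivable.
by rewrite /derive E -diff_grad// -deriveE.
Qed.

(** The mean value theorem on the segment gives the constant [L] rather than the sharp [L / 2]; the
    assumption [L < t] still leaves a positive descent constant [t - L]. *)
Lemma descent_lemma x d :
  g (x + d) <= g x + dotv (grad g x) d + L * dotv d d.
Proof.
have [||s s01] := @MVT_segment R (fun r : R => g (x + r *: d))
    (fun r => dotv (grad g (x + r *: d)) d) 0 1 ler01.
- by move=> s _; exact: is_derive_line.
- apply: derivable_within_continuous => s _.
  by have [] := is_derive_line x d s.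
rewrite scale1r scale0r addr0 subr0 mulr1 => gE.
suff : dotv (grad g (x + s *: d)) d - dotv (grad g x) d <= L * dotv d d by lra.
rewrite -dotvNl -dotvDl (le_trans (dotv_le _ _))//.
rewrite -sqr_enorm expr2 mulrA ler_wpM2r ?enorm_ge0//.
rewrite (le_trans (grad_lip _ _))// addrAC subrr add0r enormZ.
move: s01; rewrite in_itv /= => /andP[s0 s1].
have L0 : 0 <= L * enorm d.
  have := le_trans (enorm_ge0 _) (grad_lip (x + d) x).
  by rewrite [x + d - x]addrAC subrr add0r.
by rewrite ger0_norm// mulrCA ler_piMl.
Qed.

End lipschitz_gradient.

(** * Concave desingularising functions and finite length *)

Lemma concave_tangent (R : realType) (nu : R) (phi : R -> R) (r s : R) :
  @convex_function R R^o `[0, nu[ (fun s => - phi s) ->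
  0 < r < nu -> 0 <= s < nu -> derivable phi r 1 ->
  phi s - phi r <= phi^`()%classic r * (s - r).
Proof.
move=> cphi rnu snu dphi.
(* By concavity each of these right difference quotients is at least [phi s - phi r], hence so is
   their limit. *)
have D : l^-1 *: (phi (l *: (s - r) + r) - phi r) @[l --> (0:R)^'+] -->
    phi^`()%classic r * (s - r).
  have dr : differentiable phi r by exact/derivable1_diffP.
  rewrite derive1E !deriveE// mulrC -[_ * _]/(_ *: _) -linearZ [_ *: 1]mulr1 -deriveE//.
  by apply: cvg_dnbhs_at_right; exact: diff_derivable.
apply: (cvgr_to_ge D); near=> l.
have l0 : 0 < l by near: l; exact: nbhs_right_gt.
have l1 : l <= 1 by near: l; exact: nbhs_right_le.
rewrite [_ *: _]mulrC ler_pdivlMr//.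
have h01 : - phi (l * s + (1 - l) * r) <= l * - phi s + (1 - l) * - phi r.
  by apply: (cphi (Itv01 (ltW l0) l1) s r); rewrite in_setE /= in_itv /=; lra.
move: h01; have -> : l * s + (1 - l) * r = l * (s - r) + r by ring.
by rewrite [l *: _]/(l * _); lra.
Unshelve. all: by end_near. Qed.

(** Concavity and descent give [phi r - phi r' >= phi'(r) * c * e^2]; the hypothesis
    [phi'(r) * t * e >= 1] then cancels one factor [e]. *)
Lemma KL_step (R : realType) (nu : R) (phi : R -> R) (r r' c t e : R) :
  desingularizing nu phi -> 0 <= r' -> r < nu -> 0 < c -> 0 < t -> 0 <= e ->
  r' <= r - c * e ^+ 2 ->
  (0 < r -> 1 <= phi^`()%classic r * (t * e)) ->
  e <= t / c * (phi r - phi r').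
Proof.
move=> [_ cphi [phi0 phi00] [dphi _] phi'0] r'0 rnu c0 t0 e0 r'r KL.
have ce : 0 <= c * e ^+ 2 by rewrite mulr_ge0 ?sqr_ge0// ltW.
have r0 : 0 <= r by lra.
(* At [r = 0] the KL inequality says nothing, but descent together with [0 <= r'] forces [r' = 0]
   and [e = 0]. *)
have [rE|rn] := eqVneq r 0.
  have r'E : r' = 0 by lra.
  rewrite rE r'E subrr mulr0; move: ce r'r; rewrite rE r'E sub0r => ce ce'.
  have : c * e ^+ 2 <= 0 by lra.
  by rewrite pmulr_rle0// => e2; nra.
have rp : 0 < r by rewrite lt_def rn.
have r_in : r \in `]0, nu[ by rewrite in_setE /= in_itv /= rp.
have := concave_tangent _ _ _ r r' cphi ltac:(lra) ltac:(lra) (dphi _ r_in).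
have p0 := phi'0 _ r_in; have := KL rp; set p := phi^`()%classic r in p0 * => pe tan.
rewrite mulrAC ler_pdivlMr//.
have h1 : p * (c * e ^+ 2) <= phi r - phi r' by nra.
have h2 : t * (p * (c * e ^+ 2)) <= t * (phi r - phi r') by rewrite ler_pM2l.
have h3 : c * e <= (p * (t * e)) * (c * e) by rewrite ler_peMl// mulr_ge0// ltW.
by nra.
Qed.

(* [enorm (xs k - l) + C * p k] is nonincreasing as long as the sequence stays
   in the ball, so the sequence cannot leave it. *)
Lemma cvg_of_length_bound (R : realType) (n : nat) (xs : nat -> 'rV[R]_n)
    (l : 'rV[R]_n) (p : nat -> R) (C rho : R) (K : nat) :
  0 < rho -> 0 <= C -> (forall k, 0 <= p k) ->
  (forall k, (K <= k)%N -> enorm (xs k - l) < rho ->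
    enorm (xs k.+1 - xs k) <= C * (p k - p k.+1)) ->
  (forall e, 0 < e -> exists2 k, (K <= k)%N & enorm (xs k - l) + C * p k < e) ->
  xs k @[k --> \oo] --> l.
Proof.
move=> rho0 C0 p0 step small; apply/cvgrPdist_lt => e e0.
have m0 : 0 < Num.min e rho by rewrite lt_min e0.
have [k0 Kk0 k0e] := small _ m0.
have inv k : enorm (xs (k + k0)%N - l) + C * p (k + k0)%N < Num.min e rho.
  elim: k => [//|k IH]; rewrite addSn.
  have Cp : 0 <= C * p (k + k0)%N by rewrite mulr_ge0.
  have := IH; rewrite lt_min => /andP[_ IHr].
  have h1 := step (k + k0)%N (leq_trans Kk0 (leq_addl _ _)) ltac:(lra).
  have := enormD (xs (k + k0).+1 - xs (k + k0)%N) (xs (k + k0)%N - l).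
  by rewrite addrA subrK; move: IH h1; lra.
exists k0 => // k /= kk0.
rewrite distrC (le_lt_trans (norm_le_enorm _))//.
have := inv (k - k0)%N; rewrite subnK// lt_min => /andP[+ _].
by have : 0 <= C * p k by [rewrite mulr_ge0]; lra.
Qed.

(** * Descent and convergence of the iteration *)

Lemma prox0 (R : realType) (n : nat) (t : R) (x u : 'rV[R]_n) :
  0 < t -> prox (fun=> 0%E) t x u -> u = x.
Proof.
move=> t0 /(_ x); rewrite !add0e subrr lee_fin !sqr_enorm dotv0r mulr0 => h.
apply/eqP; rewrite -subr_eq0; apply/eqP/enorm_eq0.
apply/eqP; rewrite -sqrf_eq0 sqr_enorm eq_le dotv_ge0 andbT.
by move: h; rewrite pmulr_rle0// divr_gt0.
Qed.

(** Add the quadratic upper bound for [g] to the subgradient inequality for [h]; the step identity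
    turns the linear terms into [- t * enorm (x' - x) ^+ 2]. *)
Lemma dc_descent (R : realType) (n : nat) (g h : 'rV[R]_n -> R) (L t : R)
    (x y x' : 'rV[R]_n) :
  (forall x, differentiable g x) ->
  (forall x y, enorm (grad g x - grad g y) <= L * enorm (x - y)) ->
  convex_subdiff h x y -> grad g x - y = t *: (x - x') ->
  g x' - h x' <= g x - h x - (t - L) * enorm (x' - x) ^+ 2.
Proof.
move=> dg lip /(_ x') yx step.
have := descent_lemma _ _ dg lip x (x' - x); rewrite addrC subrK sqr_enorm.
have : dotv (grad g x) (x' - x) - dotv y (x' - x) = - t * dotv (x' - x) (x' - x).
  by rewrite -dotvNl -dotvDl step -opprB scalerN dotvNl dotvZl mulNr.
by lra.
Qed.

Lemma desingularizing_small (R : realType) (nu : R) (phi : R -> R) (e : R) :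
  0 < nu -> desingularizing nu phi -> 0 < e ->
  exists2 m, 0 < m & forall r, 0 <= r < m -> phi r < e.
Proof.
move=> nu0 [cphi _ [phi0 phi00] _ _] e0.
have : phi x @[x --> within `[0, nu[ (nbhs (0 : R))] --> phi 0.
  by apply: (subspace_continuousP _ _).1; rewrite // /= in_itv /= lexx.
move=> /cvgrPdist_lt /(_ e e0) /nbhs_ballP [m /= m0 hm].
exists (Num.min m nu) => [|r]; first by rewrite lt_min m0.
rewrite lt_min => /andP[r0 /andP[rm rnu]].
have := hm r; rewrite -ball_normE /= sub0r normrN ger0_norm// in_itv /= r0 => /(_ rm rnu).
by rewrite phi00 sub0r normrN; apply: le_lt_trans; exact: ler_norm.
Qed.

(** Successive differences vanish, so [ys k] tends to [grad g x], and the graph of the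
    subdifferential of [h] is closed. *)
Lemma critical_of_cvg (R : realType) (n : nat) (g h : 'rV[R]_n -> R) (t : R)
    (xs ys : nat -> 'rV[R]_n) (x : 'rV[R]_n) :
  continuous (grad g) -> @convex_function R 'rV[R]_n [set: 'rV[R]_n] h ->
  (forall k, convex_subdiff h (xs k) (ys k)) ->
  (forall k, grad g (xs k) - ys k = t *: (xs k - xs k.+1)) ->
  xs k @[k --> \oo] --> x -> critical_point g h x.
Proof.
move=> gcont hconv sub step xx.
apply: (subgradient_closed _ hconv xs ys) => //.
have -> : ys = fun k => grad g (xs k) - t *: (xs k - xs k.+1).
  by apply/funext => k; rewrite -step opprB addrC subrK.
rewrite -[X in _ --> X]subr0 -(scaler0 _ t) -(subrr x).
apply: cvgB; first exact: (continuous_cvg _ (gcont x) xx).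
apply: cvgZ; first exact: cvg_cst.
apply: cvgB => //.
by apply: (cvg_subseq _ xs S) => //; exact: leqnSn.
Qed.

Theorem theorem3p9 (R : realType) (n : nat) (g h : 'rV[R]_n -> R) (L t : R)
    (xs : nat -> 'rV[R]_n)
    (f_inf : (-oo < ereal_inf [set (g x - h x)%:E | x in [set: 'rV[R]_n]])%E)
    (g_diff : forall x, differentiable g x)
    (L_ge0 : 0 <= L)
    (grad_lip : forall x y,
        enorm (grad g x - grad g y) <= L * enorm (x - y))
    (h_convex : @convex_function R 'rV[R]_n [set: 'rV[R]_n] h)
    (f_KL : forall x, strong_KL (fun z => g z - h z) x)
    (t_gt : L < t)
    (xs_gppa : gppa_sequence (fun=> 0%E) g h t xs)
    (cluster_neq0 : cluster (xs k @[k --> \oo]) !=set0) :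
  exists xbar : 'rV[R]_n,
    xs k @[k --> \oo] --> xbar /\ critical_point g h xbar.
Proof.
have t0 : 0 < t by exact: le_lt_trans t_gt.
have gcont := grad_continuous _ _ grad_lip.
have [_ gppa] := xs_gppa.
have [ys ysP] := choice (fun k => let: ex_intro2 y hy py := gppa k in
  ex_intro (fun y => convex_subdiff h (xs k) y /\
    prox (fun=> 0%E) t (xs k - t^-1 *: (grad g (xs k) - y)) (xs k.+1))
  y (conj hy py)).
have sub k : convex_subdiff h (xs k) (ys k) by have [] := ysP k.
have step k : grad g (xs k) - ys k = t *: (xs k - xs k.+1).
  have [_ /(prox0 _ _ _ _ _ t0) ->] := ysP k.
  by rewrite opprB [_ + (_ - _)]addrC subrK scalerA mulfV ?gt_eqF// scale1r.
have [xbar /cluster_subseq [s [sk s_cvg]]] := cluster_neq0.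
exists xbar; suff xs_cvg : xs k @[k --> \oo] --> xbar.
  by split=> //; exact: critical_of_cvg gcont h_convex sub step xs_cvg.
pose f z := g z - h z; pose c := t - L.
have c0 : 0 < c by rewrite subr_gt0.
have desc k : f (xs k.+1) <= f (xs k) - c * enorm (xs k.+1 - xs k) ^+ 2.
  exact: (dc_descent _ _ _ _ _ _ _ _ _ g_diff grad_lip (sub k) (step k)).
have f_dec : {homo (f \o xs) : i j / (i <= j)%N >-> j <= i}.
  apply/nonincreasing_seqP => k /=; rewrite (le_trans (desc k))// gerBl.
  by rewrite mulr_ge0 ?sqr_ge0// ltW.
have fs_cvg : f (xs (s k)) @[k --> \oo] --> f xbar.
  apply: cvgB.
    exact: (continuous_cvg _ (differentiable_continuous (g_diff xbar)) s_cvg).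
  exact: (continuous_cvg _ (convex_continuous _ h_convex xbar) s_cvg).
(* Every value of [f] along the sequence dominates the later ones, and these approach [f xbar] along
   the subsequence. *)
have f_ge k : f xbar <= f (xs k).
  apply: (cvgr_to_le fs_cvg); exists k => // j /= kj.
  by apply: f_dec; rewrite (leq_trans kj).
have [nu [V [phi [nu0 nV dphi KL]]]] := f_KL xbar.
have [rho /= rho0 rhoV] := (nbhs_ballP _ _).1 nV.
pose r k := f (xs k) - f xbar.
have r0 k : 0 <= r k by rewrite subr_ge0.
have r_near m : 0 < m -> \forall k \near \oo, r (s k) < m.
  move=> m0; have /cvgrPdist_lt /(_ m m0) := fs_cvg; apply: filterS => k.
  by rewrite distrC ger0_norm// subr_ge0.
(* One subsequence index with [r] below [nu] suffices: [r] is nonincreasing, so the bound holds from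
   [s K] on. *)
have [K _ rK] := r_near _ nu0.
have rnu k : (s K <= k)%N -> r k < nu.
  move=> kK; rewrite (le_lt_trans _ (rK K _))//= lerD2r; exact: f_dec.
have [_ _ [phi_ge0 _] _ phi'_gt0] := dphi.
(* Outside [0, nu[ nothing is known about [phi]. *)
pose p k := if r k < nu then phi (r k) else 0.
have pE k : (s K <= k)%N -> p k = phi (r k) by move=> /rnu; rewrite /p => ->.
apply: (cvg_of_length_bound _ _ _ _ p (t / c) rho (s K)) => //.
- by rewrite divr_ge0// ltW.
- move=> k; rewrite /p; case: ifP => // rk; apply: phi_ge0.
  by rewrite in_setE /= in_itv /= r0 rk.
- move=> k kK xk; rewrite !pE//; last exact: leqW.
  apply: (KL_step _ _ _ _ _ _ _ _ dphi (r0 _) (rnu _ kK) c0 t0 (enorm_ge0 _)).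
    by have := desc k; rewrite /r; lra.
  move=> rk; have := KL (xs k).
  have Vk : V (xs k).
    apply: rhoV; rewrite -ball_normE /= distrC.
    by rewrite (le_lt_trans (norm_le_enorm _)).
  have fk : f xbar < f (xs k) < f xbar + nu.
    by rewrite -subr_gt0 rk /= addrC -ltrBlDr rnu.
  move=> /(_ Vk fk) KLk; rewrite -lee_fin (le_trans KLk)// EFinM.
  apply: lee_wpmul2l.
    by rewrite lee_fin ltW// phi'_gt0// in_setE /= in_itv /= rk rnu.
  (* The distance is at most [enorm (grad g (xs k) - ys k)], which the step identity makes [t] times
     the step length. *)
  rewrite (le_trans (clarke_dist _ _ g_diff gcont h_convex _ _ (sub k)))//.
  by rewrite lee_fin step enormZ gtr0_norm// enormB.
- move=> e e0.
  (* Half of [e] goes to the distance from [xbar] and half to the term [t / c * phi (r (s k))]. *)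
  have e' : 0 < e / 2 / (t / c) by rewrite !divr_gt0.
  have [m m0 hm] := desingularizing_small _ _ _ _ nu0 dphi e'.
  have xs_near : \forall k \near \oo, enorm (xs (s k) - xbar) < e / 2.
    have q0 : 0 < e / 2 / (n%:R + 1) by rewrite !divr_gt0// ltr_wpDl.
    have /cvgrPdist_lt /(_ _ q0) := s_cvg; apply: filterS => k.
    rewrite ltr_pdivlMr ?ltr_wpDl// distrC; apply: le_lt_trans.
    by rewrite (le_trans (enorm_le_norm _))// mulrC ler_wpM2l// lerDl.
  near \oo => k.
  exists (s k).
    rewrite (leq_trans _ (sk k))//; near: k; exact: nbhs_infty_ge.
  rewrite pE; last by rewrite (leq_trans _ (sk k))//; near: k; exact: nbhs_infty_ge.
  have : phi (r (s k)) < e / 2 / (t / c).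
    by apply: hm; rewrite r0 /=; near: k; exact: r_near.
  rewrite ltr_pdivlMr ?divr_gt0// mulrC.
  have : enorm (xs (s k) - xbar) < e / 2 by near: k.
  by lra.
Unshelve. all: by end_near. Qed.
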